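(* Let $q$ be an odd prime power, $E\subseteq\mathbb{F}_q^2$, and $\ell$ a line in $\mathbb{F}_q^2$. (i) If $|E|\,|\ell\cap E|>2q^2$, then there exists $e\in E\cap\ell$ such that $|\Delta_e(E)|>q/2$. (ii) If $|E|>(2q)^{3/2}$, then there exists $e\in E$ such that $|\Delta_e(E)|>q/2$. (iii) If $E=A\times A$ for some $A\subseteq\mathbb{F}_q$ with $|A|>(2q)^{2/3}$, then there exists $a\in A$ such that $|\Delta_{(a,a)}(A\times A)|>q/2$. (iv) If $A\subseteq\mathbb{F}_q$ and $D=A-A$ satisfy $|D|\,|A|^2>2q^2$, then there exists $a\in A$ such that \[ \frac q2\le|(a-A)^2+D^2|=|\{(a-b)^2+s^2: b\in A,\ s\in D\}|, \] and this implies $|\Delta(A\times A)|>q/2$.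
   Context: A line in $\mathbb{F}_q^2$ is an affine line. The algebraic distance between $u=(u_1,u_2)$ and $v=(v_1,v_2)$ in $\mathbb{F}_q^2$ is $\|u-v\|=(u_1-v_1)^2+(u_2-v_2)^2\in\mathbb{F}_q$. For $E\subseteq\mathbb{F}_q^2$ and $e\in\mathbb{F}_q^2$: $\Delta_e(E)=\{\|u-e\|: u\in E\}$ and $\Delta(E)=\{\|u-v\|:u,v\in E\}$. $A-A=\{a-b:a,b\in A\}$. *)

(* Defs.v *)
From HB Require Import structures.
From mathcomp Require Import all_boot all_order all_algebra.
From mathcomp Require Import reals exp.

Set Implicit Arguments.
Unset Strict Implicit.
Unset Printing Implicit Defensive.

Import Order.TTheory GRing.Theory Num.Theory.
Local Open Scope ring_scope.

Section PinnedDistances.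
Variable F : finFieldType.

Definition is_line (l : {set F * F}) : Prop :=
  exists p d : F * F,
    d != 0 /\ l = [set (p.1 + t * d.1, p.2 + t * d.2) | t : F].

Definition alg_dist (u v : F * F) : F :=
  (u.1 - v.1) ^+ 2 + (u.2 - v.2) ^+ 2.

Definition pinned_dist (e : F * F) (E : {set F * F}) : {set F} :=
  [set alg_dist u e | u in E].

Definition dist_set (E : {set F * F}) : {set F} :=
  [set alg_dist u v | u in E, v in E].

Definition diff_set (A : {set F}) : {set F} :=
  [set a - b | a in A, b in A].

End PinnedDistances.

(* Main.v *)
(* For pins p + t d on a line, the difference of the distances from u and from v
   to the pin is affine in t, so two pins can only both see u and v at equal
   distances when all pins do.  Given u, at most two points v are thus related
   to it if d is not isotropic.  If d is isotropic, all points of the line are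
   related to each other, but removing them from E costs at most q of its points
   and leaves no related pair.  Summing over the q pins of the full line gives
   an upper bound on the total number of collisions, while Cauchy-Schwarz bounds
   each pin's collisions from below by |E|^2 / q; so the pins lying in E cannot
   all have the 2 |E|^2 / q collisions forced by small pinned distance sets.
   The other parts apply this to a rich line of a parallel class, to the
   diagonal, and to the points (a, 0) of A x (A - A). *)
Require Import Defs.
From HB Require Import structures.
From mathcomp Require Import all_boot all_order all_algebra.
From mathcomp Require Import reals exp.
From mathcomp Require Import finfield zify ring.

Set Implicit Arguments.
Unset Strict Implicit.
Unset Printing Implicit Defensive.

Import Order.TTheory GRing.Theory Num.Theory.
Local Open Scope ring_scope.

(** * Counting collisions of finite maps *)

Section PinnedCollisions.
Local Open Scope nat_scope.

(** Cauchy-Schwarz against the constant 1. Doubling both sides reduces it to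
    [2 * (x i * x j) <= x i ^ 2 + x j ^ 2] for each pair of indices. *)
Lemma sqr_sum_leq_card (I : finType) (P : {set I}) (x : I -> nat) :
  (\sum_(i in P) x i) ^ 2 <= #|P| * \sum_(i in P) x i ^ 2.
Proof.
rewrite -(leq_pmul2l (ltn0Sn 1)) -mulnn big_distrlr /= big_distrr /=.
have ->: 2 * (#|P| * \sum_(i in P) x i ^ 2) =
    \sum_(i in P) \sum_(j in P) (x i ^ 2 + x j ^ 2).
  under [RHS]eq_bigr => i _ do rewrite big_split /= sum_nat_const.
  by rewrite big_split /= -big_distrr /= sum_nat_const mul2n addnn.
apply: leq_sum => i _; rewrite big_distrr /=.
by apply: leq_sum => j _; exact: nat_Cauchy.
Qed.

Definition collisions (U V : finType) (E : {set U}) (f : U -> V) : nat :=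
  \sum_(u in E) \sum_(v in E) (f u == f v).

(** Collisions are ordered pairs with the diagonal included, so they number the sum of the squared
    fibre sizes. *)
Lemma sqr_card_leq_collisions (U V : finType) (E : {set U}) (f : U -> V) :
  #|E| ^ 2 <= #|f @: E| * collisions E f.
Proof.
have fE u : u \in E -> f u \in f @: E by move=> uE; apply: imset_f.
have cardE : #|E| = \sum_(y in f @: E) \sum_(u in E) (f u == y).
  rewrite exchange_big /= -sum1_card; apply: eq_bigr => u /fE uE.
  rewrite (bigD1 (f u)) //= eqxx big1 // => y /andP[_].
  by rewrite eq_sym => /negPf->.
have -> : collisions E f = \sum_(y in f @: E) (\sum_(u in E) (f u == y)) ^ 2.
  under [RHS]eq_bigr => y _ do rewrite -mulnn big_distrlr.
  rewrite exchange_big; apply: eq_bigr => u /fE uE.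
  rewrite exchange_big; apply: eq_bigr => v _ /=.
  rewrite (bigD1 (f u)) //= eqxx mul1n big1 ?addn0 1?eq_sym //.
  by move=> y /andP[_]; rewrite eq_sym => /negPf->.
by rewrite {1}cardE; exact: sqr_sum_leq_card.
Qed.

Lemma exists_large_pinned_image (T U V : finType) (q c : nat)
    (f : T -> U -> V) (E : {set U}) (B : {set T}) :
  #|T| = q -> #|V| = q ->
  (forall u, u \in E ->
     #|[set v in E | 1 < #|[set t | f t u == f t v]|]| <= c) ->
  c * q ^ 2 < #|E| * #|B| ->
  exists2 t, t \in B & q < 2 * #|f t @: E|.
Proof.
move=> Tq Vq fibers large.
have [/existsP[t /andP[tB ?]]|small] :=
  boolP [exists t, (t \in B) && (q < 2 * #|f t @: E|)]; first by exists t.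
have coll_all t : #|E| ^ 2 <= q * collisions E (f t).
  apply: leq_trans (sqr_card_leq_collisions _ (f t)) _.
  by rewrite leq_mul2r -Vq max_card orbT.
have coll_B t : t \in B -> 2 * #|E| ^ 2 <= q * collisions E (f t).
  move=> tB; move: small; rewrite negb_exists => /forallP/(_ t).
  rewrite tB /= -leqNgt => img.
  apply: leq_trans (leq_mul img (leqnn _)).
  by rewrite -mulnA leq_mul2l sqr_card_leq_collisions orbT.
(* A pair counts for at most one pin, unless it is related, when it counts for at most
   [q = 1 + q.-1] pins. *)
have upper : \sum_t collisions E (f t) <= #|E| ^ 2 + q.-1 * (c * #|E|).
  rewrite /collisions exchange_big /=.
  apply: (@leq_trans (\sum_(u in E) (#|E| + q.-1 * c))); last first.
    by rewrite sum_nat_const; lia.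
  apply: leq_sum => u uE; rewrite exchange_big /=.
  apply: (@leq_trans (\sum_(v in E)
      (1 + q.-1 * (1 < #|[set t | f t u == f t v]|)))).
    apply: leq_sum => v vE.
    have -> : \sum_t (f t u == f t v) = #|[set t | f t u == f t v]|.
      rewrite -sum1_card [RHS]big_mkcond /=.
      by apply: eq_bigr => t _; rewrite inE; case: eqP.
    have := max_card [set t | f t u == f t v]; rewrite Tq.
    by case: (ltnP 1 _); lia.
  rewrite big_split /= sum1_card -big_distrr /= leq_add2l leq_mul2l.
  apply/orP; right; apply: leq_trans (fibers u uE).
  rewrite -sum1_card [X in _ <= X]big_mkcond [X in X <= _]big_mkcond /=.
  by apply: leq_sum => v _; rewrite inE; case: (v \in E) => //=; case: ltnP.
(* Every pin contributes [#|E| ^ 2] once, and the pins of [B] a second time. The first share cancels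
   against the leading term of [upper]. *)
have lower : #|B| * #|E| ^ 2 + q * #|E| ^ 2 <= q * \sum_t collisions E (f t).
  rewrite -{1}Tq -[#|T|]cardsT -!sum_nat_const [X in X + _]big_mkcond /=.
  under [X in _ + X]eq_bigl => t do rewrite inE.
  rewrite -big_split big_distrr /=; apply: leq_sum => t _.
  case: ifP => [tB|_]; last by rewrite add0n.
  by rewrite addnn -mul2n coll_B.
have Bq : #|B| <= q by rewrite -Tq max_card.
have E0 : 0 < #|E| by lia.
have q0 : 0 < q by nia.
exfalso.
have up2 := leq_trans lower (leq_mul (leqnn q) upper).
have : #|B| * #|E| ^ 2 <= q * q * (c * #|E|).
  have : q * (q.-1 * (c * #|E|)) <= q * q * (c * #|E|).
    by rewrite mulnA leq_mul // leq_mul // leq_pred.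
  by lia.
have : c * q ^ 2 * #|E| < #|E| * #|B| * #|E| by rewrite ltn_pmul2r.
by rewrite -!mulnn; lia.
Qed.

End PinnedCollisions.

(* Certificates for [ring]: x = y as a linear consequence of known equations. *)
Lemma eq_lin1 (S : pzRingType) (k a b x y : S) :
  a = b -> x - y = k * (a - b) -> x = y.
Proof. by move=> ->; rewrite subrr mulr0 => /subr0_eq. Qed.

Lemma eq_lin2 (S : pzRingType) (k a b m c d x y : S) :
  a = b -> c = d -> x - y = k * (a - b) + m * (c - d) -> x = y.
Proof. by move=> -> ->; rewrite !subrr !mulr0 addr0 => /subr0_eq. Qed.

(** * Pins on an affine line *)

Section LinePins.
Variable F : finFieldType.
Hypothesis two_neq0 : 2 != 0 :> F.
Implicit Types (p d u v : F * F) (t : F).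

Let pin p d t : F * F := (p.1 + t * d.1, p.2 + t * d.2).

(** The difference of the two distances is affine in [t] with slope twice the inner product of
    [v - u] and [d]; two distinct zeros kill both coefficients. *)
Lemma alg_dist_two_pins p d u v :
  (1 < #|[set t | alg_dist u (pin p d t) == alg_dist v (pin p d t)]|)%N ->
  alg_dist u p = alg_dist v p /\
  (v.1 - u.1) * d.1 + (v.2 - u.2) * d.2 = 0.
Proof.
move=> /card_gt1P[s [t [+ + st]]]; rewrite !inE /alg_dist /= => /eqP es /eqP et.
have uvd : (v.1 - u.1) * d.1 + (v.2 - u.2) * d.2 = 0.
  have st0 : 2 * (s - t) != 0 by rewrite mulf_neq0 // subr_eq0.
  by apply: (mulfI st0); apply: (eq_lin2 (k := 1) (m := - 1) es et); ring.
by split=> //; apply: (eq_lin2 (k := 1) (m := - (2 * s)) es uvd); ring.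
Qed.

(** In the plane the orthogonal complement of [d] is spanned by [d] turned by a right angle, even
    when [d] is isotropic. *)
Lemma orthogonal_dir d (w : F * F) : d != 0 ->
  w.1 * d.1 + w.2 * d.2 = 0 -> exists s, w = (- s * d.2, s * d.1).
Proof.
case: d w => d1 d2 [w1 w2] /= dn0 ort.
have [d10|d1n0] := eqVneq d1 0.
  have d2n0 : d2 != 0 by apply: contraNneq dn0 => ->; rewrite d10.
  exists (- w1 / d2); congr pair; first by field.
  by rewrite d10; apply: (mulIf d2n0); apply: (eq_lin1 (k := 1) ort); ring: d10.
exists (w2 / d1); congr pair; last by field.
apply: (mulIf d1n0); have -> : - (w2 / d1) * d2 * d1 = - (w2 * d2) by field.
by apply: (eq_lin1 (k := 1) ort); ring.
Qed.

Lemma fiber_nonisotropic p d u (E : {set F * F}) :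
  d.1 ^+ 2 + d.2 ^+ 2 != 0 ->
  (#|[set v in E | 1 < #|[set t | alg_dist u (pin p d t)
                                  == alg_dist v (pin p d t)]|]| <= 2)%N.
Proof.
move=> nd.
pose s0 := 2 * ((u.1 - p.1) * d.2 - (u.2 - p.2) * d.1) / (d.1 ^+ 2 + d.2 ^+ 2).
(* The reflection of [u] in the line; [s0] is the nonzero candidate root of the quadratic in [s]
   obtained from [v = u + s * (- d.2, d.1)]. *)
pose u' := (u.1 - s0 * d.2, u.2 + s0 * d.1).
suff sub : [set v in E | (1 < #|[set t | alg_dist u (pin p d t)
                             == alg_dist v (pin p d t)]|)%N] \subset [set u; u'].
  by apply: leq_trans (subset_leq_card sub) _; rewrite cards2; case: eqP.
apply/subsetP => v; rewrite !inE => /andP[_ /alg_dist_two_pins[dist ort]].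
have dn0 : d != 0.
  by apply: contraNneq nd => ->; rewrite /= !expr0n /= addr0.
have [s [v1 v2]] := orthogonal_dir (w := (v.1 - u.1, v.2 - u.2)) dn0 ort.
have Ev1 : v.1 = u.1 - s * d.2 by apply: (eq_lin1 (k := 1) v1); ring.
have Ev2 : v.2 = u.2 + s * d.1 by apply: (eq_lin1 (k := 1) v2); ring.
move: dist; rewrite /alg_dist Ev1 Ev2 => dist.
have /eqP : s * (s - s0) * (d.1 ^+ 2 + d.2 ^+ 2) = 0.
  have -> : s * (s - s0) * (d.1 ^+ 2 + d.2 ^+ 2) = s * (s * (d.1 ^+ 2 + d.2 ^+ 2)
      - 2 * ((u.1 - p.1) * d.2 - (u.2 - p.2) * d.1)) by rewrite /s0; field.
  by apply: (eq_lin1 (k := - 1) dist); ring.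
rewrite !mulf_eq0 (negPf nd) orbF subr_eq0 => /orP[]/eqP s_eq.
  apply/orP; left.
  by rewrite [v]surjective_pairing [u]surjective_pairing Ev1 Ev2
    s_eq !mul0r subr0 addr0.
apply/orP; right.
by rewrite [v]surjective_pairing Ev1 Ev2 s_eq.
Qed.

Lemma fiber_isotropic p d u (E : {set F * F}) :
  d != 0 -> d.1 ^+ 2 + d.2 ^+ 2 = 0 ->
  u \notin [set pin p d t | t : F] ->
  (#|[set v in E | 1 < #|[set t | alg_dist u (pin p d t)
                                  == alg_dist v (pin p d t)]|]| <= 1)%N.
Proof.
move=> dn0 nd ul.
suff sub : [set v in E | (1 < #|[set t | alg_dist u (pin p d t)
                             == alg_dist v (pin p d t)]|)%N] \subset [set u].
  by apply: leq_trans (subset_leq_card sub) _; rewrite cards1.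
apply/subsetP => v; rewrite !inE => /andP[_ /alg_dist_two_pins[dist ort]].
have [s [v1 v2]] := orthogonal_dir (w := (v.1 - u.1, v.2 - u.2)) dn0 ort.
have Ev1 : v.1 = u.1 - s * d.2 by apply: (eq_lin1 (k := 1) v1); ring.
have Ev2 : v.2 = u.2 + s * d.1 by apply: (eq_lin1 (k := 1) v2); ring.
move: dist; rewrite /alg_dist Ev1 Ev2 => dist.
(* Isotropy removes the [s ^+ 2] term; the remaining coefficient of [s] vanishes only if [u] is on
   the line. *)
have /eqP : 2 * (s * ((u.2 - p.2) * d.1 - (u.1 - p.1) * d.2)) = 0.
  by apply: (eq_lin2 (k := - 1) (m := - s ^+ 2) dist nd); ring.
rewrite !mulf_eq0 (negPf two_neq0) /= => /orP[/eqP s0|/eqP on_line].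
  by rewrite [v]surjective_pairing [u]surjective_pairing Ev1 Ev2
    s0 !mul0r subr0 addr0.
have ort' : (u.2 - p.2) * d.1 + - (u.1 - p.1) * d.2 = 0.
  by apply: (eq_lin1 (k := 1) on_line); ring.
(* Applied to [u - p] turned by a right angle, this makes [u - p] itself a multiple of [d]. *)
have [t [u2 u1]] := orthogonal_dir (w := (u.2 - p.2, - (u.1 - p.1))) dn0 ort'.
case/imsetP: ul; exists (- t) => //.
rewrite [LHS]surjective_pairing /pin; congr pair.
  by apply: (eq_lin1 (k := - 1) u1); ring.
by apply: (eq_lin1 (k := 1) u2); ring.
Qed.

Lemma exists_pin_on_line (E l : {set F * F}) : is_line l ->
  (2 * #|F| ^ 2 < #|E| * #|l :&: E|)%N ->
  exists2 e, e \in E :&: l & (#|F| < 2 * #|pinned_dist e E|)%N.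
Proof.
move=> [p [d [dn0 ->]]]; rewrite -/(pin p d); set l' := [set _ | t : F] => large.
pose B := [set t | pin p d t \in E].
have cardB : (#|l' :&: E| <= #|B|)%N.
  suff sub : l' :&: E \subset pin p d @: B.
    by apply: leq_trans (subset_leq_card sub) (leq_imset_card _ _).
  apply/subsetP => e; rewrite inE => /andP[/imsetP[t _ ->] eE].
  by apply: imset_f; rewrite inE.
have pinBl t : t \in B -> pin p d t \in E :&: l'.
  by rewrite !inE => ->; apply: imset_f.
have [nd|nd] := eqVneq (d.1 ^+ 2 + d.2 ^+ 2) 0; last first.
  have [|t tB big] := exists_large_pinned_image (c := 2) (B := B) erefl erefl
      (fun u _ => fiber_nonisotropic p u E nd).
    by apply: leq_trans large _; rewrite leq_mul2l cardB orbT.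
  by exists (pin p d t); [exact: pinBl | ].
(* An isotropic line is at distance 0 from each of its points: drop it. *)
have cardl : (#|l' :&: E| <= #|F|)%N.
  exact: leq_trans cardB (max_card _).
have [||t tB big] := exists_large_pinned_image (c := 1) (E := E :\: l') (B := B)
    (f := fun t u => alg_dist u (pin p d t)) (erefl #|F|) erefl.
- move=> u; rewrite inE => /andP[ul _]; exact: fiber_isotropic.
(* Dropping the line loses at most [#|l' :&: E| ^ 2 <= #|F| ^ 2] from the product, half of the
   assumed bound; [c = 1] needs only the other half. *)
- rewrite mul1n; apply: leq_trans (leq_mul (leqnn _) cardB).
  have := cardsID l' E; rewrite setIC => cardE.
  have := leq_mul cardl cardl; move: large; rewrite -cardE -!mulnn mulnDl.
  move: #|F| #|_ :\: _| #|_ :&: _| => a b c. lia.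
exists (pin p d t); first exact: pinBl.
apply: leq_trans big _; rewrite leq_mul2l subset_leq_card ?orbT //.
by apply: imsetS; apply: subsetDl.
Qed.

Lemma is_line_horizontal (y : F) : is_line [set (x, y) | x : F].
Proof.
exists (0, y), (1, 0); split; first by rewrite xpair_eqE /= oner_eq0.
by apply: eq_imset => t /=; rewrite add0r mulr1 mulr0 addr0.
Qed.

Lemma is_line_diagonal : is_line [set (x, x) | x : F].
Proof.
exists (0, 0), (1, 1); split; first by rewrite xpair_eqE /= oner_eq0.
by apply: eq_imset => t /=; rewrite add0r mulr1.
Qed.

(** The horizontal lines partition the plane. If none of them is rich enough, summing over all
    [#|F|] of them bounds [#|E| ^ 2] by [2 * #|F| ^ 3]. *)
Lemma exists_pin (E : {set F * F}) : (2 * #|F| ^ 3 < #|E| ^ 2)%N ->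
  exists2 e, e \in E & (#|F| < 2 * #|pinned_dist e E|)%N.
Proof.
move=> large.
have [/existsP[e /andP[eE ?]]|none] :=
  boolP [exists e, (e \in E) && (#|F| < 2 * #|pinned_dist e E|)%N].
  by exists e.
have line_bound y : (#|E| * #|[set (x, y) | x : F] :&: E| <= 2 * #|F| ^ 2)%N.
  rewrite leqNgt; apply/negP => /(exists_pin_on_line (is_line_horizontal y)).
  move=> [e]; rewrite inE => /andP[eE _] big.
  by move: none; rewrite negb_exists => /forallP/(_ e); rewrite eE big.
have cardE : #|E| = (\sum_y #|[set (x, y) | x : F] :&: E|)%N.
  rewrite -sum1_card (partition_big snd xpredT) //=; apply: eq_bigr => y _.
  rewrite -sum1_card; apply: eq_bigl => -[x z]; rewrite !inE andbC /=.
  by congr andb; apply/eqP/imsetP => [->|[w _ [_ ->]]] //; exists x.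
move: large; rewrite ltnNge => /negP[].
rewrite -mulnn {2}cardE big_distrr /=.
apply: (@leq_trans (\sum_(y : F) 2 * #|F| ^ 2)%N); first exact: leq_sum.
by rewrite sum_nat_const (mulnC #|F|) -mulnA -expnSr.
Qed.

End LinePins.

(** * Odd characteristic, real exponents and the four statements *)

Lemma finField_two_neq0 (F : finFieldType) : odd #|F| -> 2 != 0 :> F.
Proof.
move=> oddF; apply/negP => /eqP two0.
have pchar2 : 2%N \in [pchar F] by rewrite inE /= two0 eqxx.
have := finNzRing_gt1 F; move: oddF.
by rewrite (card_pprimeChar pchar2) oddX /= orbF => /eqP->.
Qed.

Lemma half_lt_natr (R : realType) (q n : nat) :
  (q < 2 * n)%N -> q%:R / 2 < n%:R :> R.
Proof.
by rewrite -(ltr_nat R) natrM => ?; rewrite ltr_pdivrMr // mulrC.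
Qed.

Lemma powR_ratio_lt_natr (R : realType) (x : R) (m k n : nat) :
  0 <= x -> (0 < k)%N -> x `^ (m%:R / k%:R) < n%:R -> x ^+ m < (n ^ k)%:R.
Proof.
move=> x0 k0 lt; rewrite natrX.
have <- : (x `^ (m%:R / k%:R)) ^+ k = x ^+ m.
  rewrite -powR_mulrn ?powR_ge0 // -powRrM divfK ?powR_mulrn //.
  by rewrite pnatr_eq0 -lt0n.
by rewrite ltrXn2r ?powR_ge0 // -lt0n.
Qed.

Theorem theorem11 (R : realType) (q : nat) (F : finFieldType)
    (hF : #|F| = q) (hq : odd q) :
  [/\ forall (E l : {set F * F}), is_line l ->
        (2 * q ^ 2 < #|E| * #|l :&: E|)%N ->
        exists2 e, e \in E :&: l & q%:R / 2 < #|pinned_dist e E|%:R :> R,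
      forall E : {set F * F},
        (2 * q%:R) `^ (3 / 2) < #|E|%:R :> R ->
        exists2 e, e \in E & q%:R / 2 < #|pinned_dist e E|%:R :> R,
      forall A : {set F},
        (2 * q%:R) `^ (2 / 3) < #|A|%:R :> R ->
        exists2 a, a \in A &
          q%:R / 2 < #|pinned_dist (a, a) (setX A A)|%:R :> R
    & forall A : {set F},
        (2 * q ^ 2 < #|diff_set A| * #|A| ^ 2)%N ->
        (exists2 a, a \in A &
          q%:R / 2 <= #|[set (a - b) ^+ 2 + s ^+ 2
                           | b in A, s in diff_set A]|%:R :> R)
        /\ q%:R / 2 < #|dist_set (setX A A)|%:R :> R].
Proof.
have two0 : 2 != 0 :> F by apply: finField_two_neq0; rewrite hF.
split.
- move=> E l line; rewrite -hF => /(exists_pin_on_line two0 line)[e eEl big].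
  by exists e => //; apply: half_lt_natr.
- move=> E large.
  have [|e eE big] := exists_pin two0 (E := E).
    have := @powR_ratio_lt_natr _ _ 3 2 _ _ isT large.
    rewrite -natrM -natrX ltr_nat hF => /(_ (ler0n _ _)).
    (* The hypothesis gives [(2 * q) ^ 3], more than the required [2 * q ^ 3]. *)
    by apply: leq_ltn_trans; rewrite expnMn leq_mul2r orbT.
  by exists e => //; rewrite -hF; apply: half_lt_natr.
- move=> A large.
  have [|e] := exists_pin_on_line two0 (is_line_diagonal F) (E := setX A A).
    have := @powR_ratio_lt_natr _ _ 2 3 _ _ isT large.
    rewrite -natrM -natrX ltr_nat hF => /(_ (ler0n _ _)) large'.
    have diagA : (#|A| <= #|[set (x, x) | x : F] :&: setX A A|)%N.
      rewrite -(card_imset A (f := fun x => (x, x))) => [|x y [] //].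
      apply: subset_leq_card; apply/subsetP => _ /imsetP[x xA ->].
      by rewrite !inE imset_f //= xA.
    rewrite cardsX; apply: leq_trans (leq_mul (leqnn _) diagA).
    rewrite mulnn -expnSr; apply: leq_ltn_trans large'.
    by rewrite expnMn leq_mul2r orbT.
  rewrite inE => /andP[/[swap] /imsetP[a _ ->]]; rewrite inE /= => /andP[aA _].
  move=> big.
  by exists a => //; rewrite -hF; apply: half_lt_natr.
move=> A large; set D := diff_set A in large *.
have [a aA big] : exists2 a, a \in A &
    (q < 2 * #|[set ((a - b) ^+ 2 + s ^+ 2)%R | b in A, s in D]|)%N.
  have [|e] := exists_pin_on_line two0 (is_line_horizontal 0) (E := setX A D).
    have rowA : (#|A| <= #|[set (x, 0%R) | x : F] :&: setX A D|)%N.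
      rewrite -(card_imset A (f := fun x => (x, 0%R : F))) => [|x y [] //].
      apply: subset_leq_card; apply/subsetP => _ /imsetP[x xA ->].
      rewrite !inE imset_f //= xA /=.
      (* The axis pins lie in [A x D] because [0 = x - x] belongs to [D]. *)
      by apply/imset2P; exists x x => //; rewrite subrr.
    rewrite cardsX hF; apply: leq_trans (leq_mul (leqnn _) rowA).
    by rewrite mulnAC mulnn [ltnRHS]mulnC.
  rewrite inE => /andP[/[swap] /imsetP[a _ ->]]; rewrite inE /= => /andP[aA _].
  rewrite hF => big; exists a => //; apply: leq_trans big _.
  rewrite leq_mul2l subset_leq_card //; apply/subsetP => _ /imsetP[[b s] + ->].
  rewrite inE /= => /andP[bA sD]; apply/imset2P; exists b s => //.
  by rewrite /alg_dist /= subr0 -opprB sqrrN.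
split; first by exists a => //; apply/ltW/half_lt_natr.
apply: half_lt_natr; apply: leq_trans big _.
rewrite leq_mul2l subset_leq_card //.
(* With [s = c - d], the value [(a - b) ^+ 2 + s ^+ 2] is the distance from [(a, c)] to [(b, d)]. *)
apply/subsetP => _ /imset2P[b _ bA /imset2P[c d cA dA ->] ->].
by apply/imset2P; exists (a, c) (b, d); rewrite ?inE /= ?aA ?bA ?cA ?dA.
Qed.
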